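(* Suppose $\lambda>1$ is a constant and $\psi:(0,1)\to(0,1)$ is a continuous function satisfying $\lim_{r\to0^+}\psi(r)=0$. Then there exist $C^\infty$ positive solutions $u(x)$ and $v(x)$ of the system $$0\le -\Delta u\le e^{v^\lambda},\qquad 0\le -\Delta v\le e^{u}\qquad\text{in } B_2(0)\setminus\{0\}\subset\mathbb{R}^2$$ such that $$u(x)\neq O\left(\psi(|x|)\left(\log\frac{2}{|x|}\right)^\lambda\right)\quad\text{as }x\to0$$ and $$\frac{v(x)}{\log\frac1{|x|}}\to1\quad\text{as }x\to0.$$
   Context: $B_r(x_0)$ denotes the open ball of radius $r$ centered at $x_0$. The notation $u(x)\ne O(k(x))$ as $x\to 0$ means that the statement ''$u(x)=O(k(x))$ as $x\to0$'' is false. *)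

(* Defs.v *)
From Stdlib Require Export Reals.
From Coquelicot Require Export Coquelicot.
Open Scope R_scope.

(* Functions on the plane are curried, [f : R -> R -> R], as in Coquelicot's
   two-dimensional calculus ([ex_diff_n], [partial_derive]). *)

Definition enorm (x y : R) : R := sqrt (x ^ 2 + y ^ 2).

Definition punctured_ball (r x y : R) : Prop := 0 < enorm x y < r.

(* [ex_diff_n f n x y]: every partial derivative of [f] of order at most [n]
   exists and is continuous at [(x, y)].  Only meaningful for open [D]. *)
Definition smooth_on (D : R -> R -> Prop) (f : R -> R -> R) : Prop :=
  forall (x y : R), D x y -> forall n : nat, ex_diff_n f n x y.

Definition laplacian (f : R -> R -> R) (x y : R) : R :=
  partial_derive 2 0 f x y + partial_derive 0 2 f x y.

(* The uniform structure on [R * R] uses the max norm; it has the same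
   punctured neighbourhoods of the origin as the Euclidean one. *)
Definition near_origin : (R * R -> Prop) -> Prop := locally' (0, 0).

Definition is_bigO {T : Type} (F : (T -> Prop) -> Prop) (f g : T -> R) : Prop :=
  exists C : R, F (fun t => Rabs (f t) <= C * Rabs (g t)).

(* Main.v *)
Require Import Defs.
From Stdlib Require Import Reals Lra Lia ClassicalEpsilon.
From Coquelicot Require Import Coquelicot.
Open Scope R_scope.

(** The second equation is solved by a harmonic function,
    [v = ln 2 + B - ln |p|] with a constant [B > 1], so that [- Delta v = 0] and
    [v / ln (1 / |p|)] tends to [1].  What remains is a scalar problem: a
    positive [u] with [0 <= - Delta u <= exp (v ^ lambda)] that peaks on a
    sequence of points tending to the origin.

    The building block is [- ln q] with [q = |p - (t, 0)|^2 + s].  It is smooth,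
    and [- Delta (- ln q) = 4 s / q^2] is a positive bump of total mass
    independent of [s] and height [4 / s], whereas [- ln q] reaches
    [ln (1 / s)] at its centre.  The right-hand side allows bumps of height
    [exp (v ^ lambda)], so one takes [s = exp (- (B - ln t) ^ lambda)]; the peak
    is then [(B - ln t) ^ lambda], the order of [(ln (2 / t)) ^ lambda].  The
    solution is [u = sum_j w_j (ln 10 - ln q_j)] with [w_j = 2^-j / 8]: the
    number [10] bounds every [q_j] on the ball of radius [2], which makes all
    terms positive, and since the [4 w_j] add up to [1], the bound on
    [- Delta u] follows from the bound [s_j / q_j^2 <= exp (v ^ lambda)] on each
    bump separately ([bump_density_le]).  Near the origin and the centre of the bump, its
    maximum [1 / s_j] is admissible by the choice of [s_j]; away from the centre
    [s_j / q_j^2 <= s_j / t_j^4], and this is at most [1] because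
    [lambda > 1] makes [(B - ln t) ^ lambda >= 4 (B - ln t)] once [B] is large
    ([Rpower_ge_linear]).  Finally [t_j] is chosen so close to [0] that
    [psi t_j < w_j / (j + 1)]; then [u (t_j, 0) >= w_j (ln (2 / t_j)) ^ lambda]
    exceeds [(j + 1) psi t_j (ln (2 / t_j)) ^ lambda].

    Smoothness of the infinite sum away from the origin is obtained for all
    orders at once ([smooth_weighted_sum]).  Call a set of families
    [f_j] differential if each of its members is bounded locally uniformly in
    [j] and has both partial derivatives in the set.  A bound on second
    derivatives makes the remainders of first order expansions uniform in [j],
    so a sum [sum_j w_j f_j] with summable weights is differentiated term by
    term, and its derivatives are sums of the same kind.  The families
    generated by constants, [x - t_j], [y], [1 / q_j] and [ln q_j] under sums
    and products form such a set, because the [q_j] have a common positive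
    lower bound near each point other than the origin.  The logarithm [v]
    is also written as such a sum, with all centres and all [s_j] equal to
    [0]. *)

(** * Sums with summable weights *)

Definition summable_weights (w : nat -> R) : Prop :=
  (forall j, 0 <= w j) /\ ex_series w.

Definition weighted_sum (w : nat -> R) (f : nat -> R -> R -> R) (x y : R) : R :=
  Series (fun j => w j * f j x y).

Lemma ex_series_Rmult_l (c : R) (a : nat -> R) :
  ex_series a -> ex_series (fun j => c * a j).
Proof. exact (ex_series_scal_l (K := R_AbsRing) (V := R_NormedModule) c a). Qed.

Lemma Series_weights_nonneg (w : nat -> R) : summable_weights w -> 0 <= Series w.
Proof.
  intros [Hw Hs].
  replace 0 with (Series (fun n => 0 * w n)) by (rewrite Series_scal_l; ring).
  apply Series_le; [intros n; specialize (Hw n); lra | exact Hs].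
Qed.

Lemma ex_series_weighted (w a : nat -> R) (M : R) :
  summable_weights w -> (forall j, Rabs (a j) <= M) ->
  ex_series (fun j => w j * a j).
Proof.
  intros [Hw Hs] Ha.
  apply (ex_series_le (K := R_AbsRing) (V := R_CompleteNormedModule) _ (fun j => M * w j)).
  - intros j. change (Rabs (w j * a j) <= M * w j).
    rewrite Rabs_mult, (Rabs_pos_eq (w j)) by apply Hw.
    rewrite Rmult_comm. apply Rmult_le_compat_r; auto.
  - apply ex_series_Rmult_l. exact Hs.
Qed.

Lemma Rabs_Series_weighted (w a : nat -> R) (M : R) :
  summable_weights w -> (forall j, Rabs (a j) <= M) ->
  Rabs (Series (fun j => w j * a j)) <= Series w * M.
Proof.
  intros Hw Ha.
  assert (Hex : ex_series (fun j => Rabs (w j * a j))).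
  { apply ex_series_ext with (fun j => w j * Rabs (a j)).
    - intros j. rewrite Rabs_mult, (Rabs_pos_eq (w j)) by apply (proj1 Hw). reflexivity.
    - apply ex_series_weighted with M; [exact Hw |]. intros j. rewrite Rabs_Rabsolu. apply Ha. }
  eapply Rle_trans; [apply Series_Rabs, Hex |].
  rewrite Rmult_comm, <- Series_scal_l.
  apply Series_le.
  - intros j. split; [apply Rabs_pos |].
    rewrite Rabs_mult, (Rabs_pos_eq (w j)) by apply (proj1 Hw).
    rewrite Rmult_comm. apply Rmult_le_compat_r; [apply (proj1 Hw) | apply Ha].
  - apply ex_series_Rmult_l. apply Hw.
Qed.

(** The bound on the second derivatives gives
    [|f_j (x0 + h) - f_j x0 - h f'_j x0| <= M h^2] with one constant for all [j];
    summing this keeps the error quadratic in [h]. *)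
Lemma is_derive_Series_weighted (w : nat -> R) (f f' f'' : nat -> R -> R) (x0 d M : R) :
  summable_weights w -> 0 < d ->
  (forall j x, Rabs (x - x0) < d ->
     is_derive (f j) x (f' j x) /\ is_derive (f' j) x (f'' j x) /\
     Rabs (f j x) <= M /\ Rabs (f' j x) <= M /\ Rabs (f'' j x) <= M) ->
  is_derive (fun x => Series (fun j => w j * f j x)) x0
    (Series (fun j => w j * f' j x0)).
Proof.
  intros Hw Hd H.
  assert (H0 : Rabs (x0 - x0) < d) by (rewrite Rminus_diag, Rabs_R0; exact Hd).
  assert (HM : 0 <= M).
  { apply Rle_trans with (2 := proj1 (proj2 (proj2 (H 0%nat x0 H0)))). apply Rabs_pos. }
  pose proof (Series_weights_nonneg w Hw) as HW.
  assert (HT : forall j h, Rabs h < d ->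
    Rabs (f j (x0 + h) - f j x0 - h * f' j x0) <= M * Rabs h * Rabs h).
  { intros j h Hh.
    pose (g := fun t => f j t - t * f' j x0).
    (* The mean value inequality is used twice: for [g], whose derivative is
       [f' t - f' x0], and for that derivative. *)
    assert (Hg : Rabs (g (x0 + h) - g x0) <= M * Rabs h * Rabs (x0 + h - x0)).
    { apply bounded_variation with (dh := fun t => f' j t - f' j x0).
      replace (x0 + h - x0) with h by ring.
      intros t Ht. assert (Htd : Rabs (t - x0) < d) by lra.
      destruct (H j t Htd) as (D1 & _).
      split.
      - unfold g. apply (is_derive_minus (K := R_AbsRing) (V := R_NormedModule)); [exact D1 |].
        auto_derive; [exact I | ring].
      - apply Rle_trans with (M * Rabs (t - x0)); [| apply Rmult_le_compat_l; lra].
        apply bounded_variation with (dh := f'' j).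
        intros s Hs. assert (Hsd : Rabs (s - x0) < d) by lra.
        destruct (H j s Hsd) as (_ & D2 & _ & _ & B2). now split. }
    unfold g in Hg. replace (x0 + h - x0) with h in Hg by ring.
    replace (f j (x0 + h) - f j x0 - h * f' j x0)
      with (f j (x0 + h) - (x0 + h) * f' j x0 - (f j x0 - x0 * f' j x0)) by ring.
    exact Hg. }
  apply is_derive_Reals. intros eps Heps.
  pose (C := Series w * M + 1).
  assert (HC : 0 < C) by (unfold C; nra).
  assert (Hdel : 0 < Rmin d (eps / C)) by (apply Rmin_pos; [lra | now apply Rdiv_lt_0_compat]).
  exists (mkposreal _ Hdel). intros h Hh0 Hh. simpl in Hh.
  assert (Hhd : Rabs h < d) by (eapply Rlt_le_trans; [exact Hh | apply Rmin_l]).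
  assert (Hhe : Rabs h < eps / C) by (eapply Rlt_le_trans; [exact Hh | apply Rmin_r]).
  assert (Hxh : Rabs (x0 + h - x0) < d) by (replace (x0 + h - x0) with h by ring; exact Hhd).
  assert (E1 : ex_series (fun j => w j * f j (x0 + h)))
    by (apply ex_series_weighted with M; [exact Hw | intros j; apply (H j _ Hxh)]).
  assert (E2 : ex_series (fun j => w j * f j x0))
    by (apply ex_series_weighted with M; [exact Hw | intros j; apply (H j _ H0)]).
  assert (E3 : ex_series (fun j => w j * f' j x0))
    by (apply ex_series_weighted with M; [exact Hw | intros j; apply (H j _ H0)]).
  assert (B : Rabs (Series (fun j => w j * f j (x0 + h)) - Series (fun j => w j * f j x0)
                    - h * Series (fun j => w j * f' j x0))
              <= Series w * (M * Rabs h * Rabs h)).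
  { rewrite <- Series_scal_l, <- Series_minus by assumption.
    rewrite <- Series_minus;
      [ | exact (ex_series_minus _ _ E1 E2) | exact (ex_series_Rmult_l h _ E3)].
    rewrite Series_ext with (b := fun j => w j * (f j (x0 + h) - f j x0 - h * f' j x0))
      by (intros j; ring).
    apply Rabs_Series_weighted; [exact Hw |]. intros j. now apply HT. }
  assert (Hhp : 0 < Rabs h) by now apply Rabs_pos_lt.
  match goal with |- Rabs (?a / h - ?b) < eps =>
    replace (a / h - b) with ((a - h * b) / h) by (field; exact Hh0) end.
  unfold Rdiv at 1. rewrite Rabs_mult, Rabs_inv.
  apply Rmult_lt_reg_r with (Rabs h); [exact Hhp |].
  rewrite Rmult_assoc, Rinv_l, Rmult_1_r by lra.
  eapply Rle_lt_trans; [exact B |].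
  assert (C * Rabs h < eps).
  { apply Rmult_lt_compat_l with (r := C) in Hhe; [| exact HC].
    replace (C * (eps / C)) with eps in Hhe by (field; lra). exact Hhe. }
  unfold C in *. nra.
Qed.

(** * Term by term differentiation in the plane *)

Definition locally_uniformly_bounded (f : nat -> R -> R -> R) (x y : R) : Prop :=
  exists M, locally_2d (fun u v => forall j, Rabs (f j u v) <= M) x y.

Definition have_partials_on (D : R -> R -> Prop) (f fx fy : nat -> R -> R -> R) : Prop :=
  forall x y, D x y -> forall j,
    is_derive (fun z => f j z y) x (fx j x y) /\
    is_derive (fun z => f j x z) y (fy j x y).

(** Closure under both partial derivatives turns a local bound on the members
    into a local bound on the derivatives of every order, which is what allows
    a single induction to reach smoothness. *)
Definition differential_class (D : R -> R -> Prop)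
  (K : (nat -> R -> R -> R) -> Prop) : Prop :=
  forall f, K f ->
    (forall x y, D x y -> locally_uniformly_bounded f x y) /\
    exists fx fy, K fx /\ K fy /\ have_partials_on D f fx fy.

Definition open_2d (D : R -> R -> Prop) : Prop :=
  forall x y, D x y -> locally_2d D x y.

Lemma is_derive_weighted_sum (D : R -> R -> Prop) (K : (nat -> R -> R -> R) -> Prop)
  (w : nat -> R) (f fx fy : nat -> R -> R -> R) :
  open_2d D -> differential_class D K -> summable_weights w ->
  K f -> K fx -> K fy -> have_partials_on D f fx fy ->
  forall x y, D x y ->
    is_derive (fun z => weighted_sum w f z y) x (weighted_sum w fx x y) /\
    is_derive (fun z => weighted_sum w f x z) y (weighted_sum w fy x y).
Proof.
  intros HD HK Hw Kf Kfx Kfy Hp x y Dxy.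
  destruct (HK f Kf) as [Bf _].
  destruct (HK fx Kfx) as [Bfx (fxx & fxy & Kxx & _ & Px)].
  destruct (HK fy Kfy) as [Bfy (fyx & fyy & _ & Kyy & Py)].
  destruct (HK fxx Kxx) as [Bxx _]. destruct (HK fyy Kyy) as [Byy _].
  destruct (Bf x y Dxy) as [M0 L0].
  destruct (Bfx x y Dxy) as [M1 L1]. destruct (Bfy x y Dxy) as [M2 L2].
  destruct (Bxx x y Dxy) as [M3 L3]. destruct (Byy x y Dxy) as [M4 L4].
  pose proof (locally_2d_and _ _ _ _ (HD x y Dxy)
    (locally_2d_and _ _ _ _ L0
      (locally_2d_and _ _ _ _ (locally_2d_and _ _ _ _ L1 L2)
                              (locally_2d_and _ _ _ _ L3 L4)))) as [d L].
  clear L0 L1 L2 L3 L4.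
  assert (Hx0 : Rabs (x - x) < d) by (rewrite Rminus_diag, Rabs_R0; apply d).
  assert (Hy0 : Rabs (y - y) < d) by (rewrite Rminus_diag, Rabs_R0; apply d).
  pose (M := Rmax M0 (Rmax (Rmax M1 M2) (Rmax M3 M4))).
  assert (HM : M0 <= M /\ M1 <= M /\ M2 <= M /\ M3 <= M /\ M4 <= M).
  { unfold M, Rmax. repeat destruct Rle_dec; lra. }
  split.
  - apply is_derive_Series_weighted with (f := fun j z => f j z y) (f' := fun j z => fx j z y)
      (f'' := fun j z => fxx j z y) (d := d) (M := M); [exact Hw | apply d |].
    intros j z Hz. destruct (L z y Hz Hy0) as (Dz & A0 & (A1 & _) & (A3 & _)).
    specialize (A0 j). specialize (A1 j). specialize (A3 j).
    split; [apply (Hp z y Dz) | split; [apply (Px z y Dz) | repeat split; lra]].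
  - apply is_derive_Series_weighted with (f := fun j z => f j x z) (f' := fun j z => fy j x z)
      (f'' := fun j z => fyy j x z) (d := d) (M := M); [exact Hw | apply d |].
    intros j z Hz. destruct (L x z Hx0 Hz) as (Dz & A0 & (_ & A1) & (_ & A3)).
    specialize (A0 j). specialize (A1 j). specialize (A3 j).
    split; [apply (Hp x z Dz) | split; [apply (Py x z Dz) | repeat split; lra]].
Qed.

(** [smooth_on] asks for joint continuity, which separate differentiability does
    not give; the bounds on the first derivatives make the terms
    Lipschitz with a constant independent of [j]. *)
Lemma continuity_weighted_sum (D : R -> R -> Prop) (K : (nat -> R -> R -> R) -> Prop)
  (w : nat -> R) (f : nat -> R -> R -> R) :
  open_2d D -> differential_class D K -> summable_weights w -> K f ->
  forall x y, D x y -> continuity_2d_pt (weighted_sum w f) x y.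
Proof.
  intros HD HK Hw Kf x y Dxy.
  destruct (HK f Kf) as [Bf (fx & fy & Kx & Ky & P)].
  destruct (HK fx Kx) as [Bx _]. destruct (HK fy Ky) as [By _].
  destruct (Bf x y Dxy) as [M0 L0].
  destruct (Bx x y Dxy) as [M1 L1]. destruct (By x y Dxy) as [M2 L2].
  pose proof (locally_2d_and _ _ _ _ (HD x y Dxy)
    (locally_2d_and _ _ _ _ L0 (locally_2d_and _ _ _ _ L1 L2))) as [d L].
  clear L0 L1 L2.
  assert (Hx0 : Rabs (x - x) < d) by (rewrite Rminus_diag, Rabs_R0; apply d).
  assert (Hy0 : Rabs (y - y) < d) by (rewrite Rminus_diag, Rabs_R0; apply d).
  assert (HM1 : 0 <= M1)
    by (apply Rle_trans with (2 := proj1 (proj2 (proj2 (L x y Hx0 Hy0))) 0%nat); apply Rabs_pos).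
  assert (HM2 : 0 <= M2)
    by (apply Rle_trans with (2 := proj2 (proj2 (proj2 (L x y Hx0 Hy0))) 0%nat); apply Rabs_pos).
  pose proof (Series_weights_nonneg w Hw) as HW.
  intros eps. pose (C := Series w * (M1 + M2) + 1).
  assert (HC : 0 < C) by (unfold C; nra).
  assert (Hdel : 0 < Rmin d (eps / C))
    by (apply Rmin_pos; [apply d | apply Rdiv_lt_0_compat; [apply eps | exact HC]]).
  exists (mkposreal _ Hdel). simpl. intros u v Hu Hv.
  assert (Hud : Rabs (u - x) < d) by (eapply Rlt_le_trans; [exact Hu | apply Rmin_l]).
  assert (Hvd : Rabs (v - y) < d) by (eapply Rlt_le_trans; [exact Hv | apply Rmin_l]).
  set (h := Rmin d (eps / C)) in *.
  assert (Hh : C * h <= eps).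
  { replace (pos eps) with (C * (eps / C)) by (field; lra).
    apply Rmult_le_compat_l; [lra | apply Rmin_r]. }
  assert (T : forall j, Rabs (f j u v - f j x y) <= (M1 + M2) * h).
  { intros j.
    assert (T1 : Rabs (f j u v - f j x v) <= M1 * Rabs (u - x)).
    { apply (bounded_variation (fun z => f j z v) (fun z => fx j z v)).
      intros t Ht. destruct (L t v) as (Dt & _ & B & _); [lra | exact Hvd |].
      split; [apply (P t v Dt) | apply B]. }
    assert (T2 : Rabs (f j x v - f j x y) <= M2 * Rabs (v - y)).
    { apply (bounded_variation (fun z => f j x z) (fun z => fy j x z)).
      intros t Ht. destruct (L x t) as (Dt & _ & _ & B); [exact Hx0 | lra |].
      split; [apply (P x t Dt) | apply B]. }
    replace (f j u v - f j x y) with ((f j u v - f j x v) + (f j x v - f j x y)) by ring.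
    eapply Rle_trans; [apply Rabs_triang |]. nra. }
  unfold weighted_sum. rewrite <- Series_minus.
  - rewrite Series_ext with (b := fun j => w j * (f j u v - f j x y)) by (intros j; ring).
    eapply Rle_lt_trans; [apply Rabs_Series_weighted; [exact Hw | exact T] |].
    assert (0 < h) by exact Hdel. unfold C in *. nra.
  - apply ex_series_weighted with M0; [exact Hw |]. intros j. now apply (L u v).
  - apply ex_series_weighted with M0; [exact Hw |]. intros j. now apply (L x y).
Qed.

Lemma locally_2d_of_open (D P : R -> R -> Prop) (x y : R) :
  open_2d D -> D x y -> (forall u v, D u v -> P u v) -> locally_2d P x y.
Proof.
  intros HD Dxy H. apply locally_2d_impl with (2 := HD x y Dxy).
  apply locally_2d_forall. exact H.
Qed.

(** The induction runs over all members of the class at once: near each point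
    of [D] the partial derivatives of the sum coincide with sums of other members. *)
Theorem smooth_weighted_sum (D : R -> R -> Prop) (K : (nat -> R -> R -> R) -> Prop)
  (w : nat -> R) (f : nat -> R -> R -> R) :
  open_2d D -> differential_class D K -> summable_weights w -> K f ->
  smooth_on D (weighted_sum w f).
Proof.
  intros HD HK Hw Kf x y Dxy n.
  revert f Kf x y Dxy. induction n as [| n IH]; intros f Kf x y Dxy.
  - split; [| exact I]. now apply (continuity_weighted_sum D K).
  - destruct (HK f Kf) as [_ (fx & fy & Kx & Ky & P)].
    pose proof (is_derive_weighted_sum D K w f fx fy HD HK Hw Kf Kx Ky P) as Der.
    split; [now apply (continuity_weighted_sum D K) |].
    split; [exists (weighted_sum w fx x y); exact (proj1 (Der x y Dxy)) |].
    split; [exists (weighted_sum w fy x y); exact (proj2 (Der x y Dxy)) |].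
    split.
    + apply ex_diff_n_ext_loc with (weighted_sum w fx); [| now apply IH].
      apply (locally_2d_of_open D); [exact HD | exact Dxy |].
      intros u v Duv. symmetry. apply is_derive_unique. exact (proj1 (Der u v Duv)).
    + apply ex_diff_n_ext_loc with (weighted_sum w fy); [| now apply IH].
      apply (locally_2d_of_open D); [exact HD | exact Dxy |].
      intros u v Duv. symmetry. apply is_derive_unique. exact (proj2 (Der u v Duv)).
Qed.

Lemma laplacian_of_derivatives (D : R -> R -> Prop) (F Fx Fy Fxx Fyy : R -> R -> R) :
  open_2d D ->
  (forall x y, D x y -> is_derive (fun z => F z y) x (Fx x y) /\
                        is_derive (fun z => F x z) y (Fy x y)) ->
  (forall x y, D x y -> is_derive (fun z => Fx z y) x (Fxx x y)) ->
  (forall x y, D x y -> is_derive (fun z => Fy x z) y (Fyy x y)) ->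
  forall x y, D x y -> laplacian F x y = Fxx x y + Fyy x y.
Proof.
  intros HD H1 Hx Hy x y Dxy. unfold laplacian, partial_derive. simpl. f_equal.
  - rewrite (Derive_ext_loc _ (fun z => Fx z y)).
    + apply is_derive_unique, Hx, Dxy.
    + apply (locally_2d_1d_const_y (fun z v => Derive (fun t => F t v) z = Fx z v)).
      apply (locally_2d_of_open D); [exact HD | exact Dxy |].
      intros u v Duv. apply is_derive_unique. now apply H1.
  - rewrite (Derive_ext_loc _ (fun z => Fy x z)).
    + apply is_derive_unique, Hy, Dxy.
    + apply (locally_2d_1d_const_x (fun u z => Derive (fun t => F u t) z = Fy u z)).
      apply (locally_2d_of_open D); [exact HD | exact Dxy |].
      intros u v Duv. apply is_derive_unique. now apply H1.
Qed.

(** * Logarithmic potentials of softened poles *)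

(** The squared distance to the pole [(a j, 0)], shifted by [s j] so that its
    logarithm stays finite at the pole. *)
Definition softened_sqdist (a s : nat -> R) (j : nat) (x y : R) : R :=
  (x - a j) ^ 2 + y ^ 2 + s j.

(** A set that contains [ln q_j] and that differentiation does not leave: the
    derivatives of [ln q_j] and [1 / q_j] only add the factors [x - a_j], [y]
    and [1 / q_j]. *)
Inductive rational_log_class (a s : nat -> R) : (nat -> R -> R -> R) -> Prop :=
| rlc_const (c : R) : rational_log_class a s (fun _ _ _ => c)
| rlc_x : rational_log_class a s (fun j x _ => x - a j)
| rlc_y : rational_log_class a s (fun _ _ y => y)
| rlc_inv : rational_log_class a s (fun j x y => / softened_sqdist a s j x y)
| rlc_ln : rational_log_class a s (fun j x y => ln (softened_sqdist a s j x y))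
| rlc_plus (f g : nat -> R -> R -> R) :
    rational_log_class a s f -> rational_log_class a s g ->
    rational_log_class a s (fun j x y => f j x y + g j x y)
| rlc_mult (f g : nat -> R -> R -> R) :
    rational_log_class a s f -> rational_log_class a s g ->
    rational_log_class a s (fun j x y => f j x y * g j x y).

(** A lower bound uniform in [j], as the poles may accumulate: this is the set
    where [1 / q_j] and [ln q_j] are locally bounded independently of [j]. *)
Definition off_poles (a s : nat -> R) (x y : R) : Prop :=
  exists m, 0 < m /\ locally_2d (fun u v => forall j, m <= softened_sqdist a s j u v) x y.

Lemma open_off_poles (a s : nat -> R) : open_2d (off_poles a s).
Proof.
  intros x y (m & Hm & [d L]).
  assert (Hd2 : 0 < d / 2) by (generalize (cond_pos d); lra).
  exists (mkposreal _ Hd2). simpl. intros u v Hu Hv.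
  exists m. split; [exact Hm |]. exists (mkposreal _ Hd2). simpl. intros u' v' Hu' Hv' j.
  apply L.
  - replace (u' - x) with ((u' - u) + (u - x)) by ring.
    eapply Rle_lt_trans; [apply Rabs_triang | lra].
  - replace (v' - y) with ((v' - v) + (v - y)) by ring.
    eapply Rle_lt_trans; [apply Rabs_triang | lra].
Qed.

Lemma off_poles_pos (a s : nat -> R) (x y : R) :
  off_poles a s x y -> forall j, 0 < softened_sqdist a s j x y.
Proof.
  intros (m & Hm & L) j. apply locally_2d_singleton in L.
  now apply Rlt_le_trans with m.
Qed.

Lemma bounded_of_local_bound (f : nat -> R -> R -> R) (M : R) (P : R -> R -> Prop) (x y : R) :
  locally_2d P x y -> (forall u v, P u v -> forall j, Rabs (f j u v) <= M) ->
  locally_uniformly_bounded f x y.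
Proof.
  intros L H. exists M. apply locally_2d_impl with (2 := L).
  apply locally_2d_forall. exact H.
Qed.

Lemma locally_2d_unit_box (x y : R) :
  locally_2d (fun u v => Rabs (u - x) < 1 /\ Rabs (v - y) < 1) x y.
Proof. exists (mkposreal 1 Rlt_0_1). simpl. now split. Qed.

Lemma rational_log_class_bounded (a s : nat -> R) (f : nat -> R -> R -> R) :
  (forall j, 0 <= a j <= 1) -> (forall j, 0 <= s j <= 1) ->
  rational_log_class a s f ->
  forall x y, off_poles a s x y -> locally_uniformly_bounded f x y.
Proof.
  intros Ha Hs Hf x y Hxy. induction Hf as
    [c | | | | | f g _ [M1 L1] _ [M2 L2] | f g _ [M1 L1] _ [M2 L2]].
  - apply (bounded_of_local_bound _ (Rabs c) _ _ _ (locally_2d_unit_box x y)).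
    intros; apply Rle_refl.
  - apply (bounded_of_local_bound _ (Rabs x + 2) _ _ _ (locally_2d_unit_box x y)).
    intros u v [Hu _] j.
    cbv beta. specialize (Ha j). revert Hu. unfold Rabs; repeat destruct Rcase_abs; lra.
  - apply (bounded_of_local_bound _ (Rabs y + 1) _ _ _ (locally_2d_unit_box x y)).
    intros u v [_ Hv] j.
    cbv beta. revert Hv. unfold Rabs; repeat destruct Rcase_abs; lra.
  - destruct Hxy as (m & Hm & L). apply (bounded_of_local_bound _ (/ m) _ _ _ L).
    intros u v H j.
    specialize (H j). rewrite Rabs_pos_eq.
    + now apply Rinv_le_contravar.
    + apply Rlt_le, Rinv_0_lt_compat. lra.
  - destruct Hxy as (m & Hm & L).
    apply (bounded_of_local_bound _ (Rabs (ln m) + ((Rabs x + 2) ^ 2 + (Rabs y + 1) ^ 2 + 1)) _ _ _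
             (locally_2d_and _ _ _ _ L (locally_2d_unit_box x y))).
    intros u v [H [Hu Hv]] j. specialize (H j). specialize (Ha j). specialize (Hs j).
    assert (Hlow : ln m <= ln (softened_sqdist a s j u v)) by (apply ln_le; lra).
    assert (Hup : ln (softened_sqdist a s j u v) < softened_sqdist a s j u v).
    { apply exp_lt_inv. rewrite exp_ln by lra.
      generalize (exp_ineq1 (softened_sqdist a s j u v)); lra. }
    assert (Hu2 : Rabs (u - a j) <= Rabs x + 2)
      by (revert Hu; unfold Rabs; repeat destruct Rcase_abs; lra).
    assert (Hv2 : Rabs v <= Rabs y + 1)
      by (revert Hv; unfold Rabs; repeat destruct Rcase_abs; lra).
    assert (Hu3 : (u - a j) ^ 2 <= (Rabs x + 2) ^ 2)
      by (rewrite <- (pow2_abs (u - a j)); apply pow_incr; split; [apply Rabs_pos | exact Hu2]).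
    assert (Hv3 : v ^ 2 <= (Rabs y + 1) ^ 2)
      by (rewrite <- (pow2_abs v); apply pow_incr; split; [apply Rabs_pos | exact Hv2]).
    unfold softened_sqdist in *. clear Hu Hv Hu2 Hv2.
    apply Rabs_le. generalize (Rle_abs (ln m)) (Rle_abs (- ln m)). rewrite Rabs_Ropp.
    generalize (pow2_ge_0 (Rabs x + 2)) (pow2_ge_0 (Rabs y + 1)).
    intros; split; lra.
  - apply (bounded_of_local_bound _ (M1 + M2) _ _ _ (locally_2d_and _ _ _ _ L1 L2)).
    intros u v [H1 H2] j.
    eapply Rle_trans; [apply Rabs_triang |]. now apply Rplus_le_compat.
  - apply (bounded_of_local_bound _ (M1 * M2) _ _ _ (locally_2d_and _ _ _ _ L1 L2)).
    intros u v [H1 H2] j.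
    rewrite Rabs_mult. apply Rmult_le_compat; auto using Rabs_pos.
Qed.

Lemma rational_log_class_partials (a s : nat -> R) (f : nat -> R -> R -> R) :
  rational_log_class a s f ->
  exists fx fy, rational_log_class a s fx /\ rational_log_class a s fy /\
    have_partials_on (off_poles a s) f fx fy.
Proof.
  intros Hf. induction Hf as
    [c | | | | | f g Kf (fx & fy & Kfx & Kfy & Df) Kg (gx & gy & Kgx & Kgy & Dg)
     | f g Kf (fx & fy & Kfx & Kfy & Df) Kg (gx & gy & Kgx & Kgy & Dg)].
  - exists (fun _ _ _ => 0), (fun _ _ _ => 0).
    split; [constructor | split; [constructor |]].
    intros x y _ j. split; (auto_derive; [exact I | ring]).
  - exists (fun _ _ _ => 1), (fun _ _ _ => 0).
    split; [constructor | split; [constructor |]].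
    intros x y _ j. split; (auto_derive; [exact I | ring]).
  - exists (fun _ _ _ => 0), (fun _ _ _ => 1).
    split; [constructor | split; [constructor |]].
    intros x y _ j. split; (auto_derive; [exact I | ring]).
  - exists (fun j x y => -2 * (x - a j) *
              (/ softened_sqdist a s j x y * / softened_sqdist a s j x y)),
      (fun j x y => -2 * y * (/ softened_sqdist a s j x y * / softened_sqdist a s j x y)).
    split; [repeat constructor | split; [repeat constructor |]].
    intros x y Hxy j. pose proof (off_poles_pos a s x y Hxy j) as Hq.
    unfold softened_sqdist in *. split; (auto_derive; [lra | field; lra]).
  - exists (fun j x y => 2 * (x - a j) * / softened_sqdist a s j x y),
      (fun j x y => 2 * y * / softened_sqdist a s j x y).
    split; [repeat constructor | split; [repeat constructor |]].
    intros x y Hxy j. pose proof (off_poles_pos a s x y Hxy j) as Hq.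
    unfold softened_sqdist in *. split; (auto_derive; [lra | field; lra]).
  - exists (fun j x y => fx j x y + gx j x y), (fun j x y => fy j x y + gy j x y).
    split; [now constructor | split; [now constructor |]].
    intros x y Hxy j. destruct (Df x y Hxy j), (Dg x y Hxy j).
    split; now apply (is_derive_plus (K := R_AbsRing) (V := R_NormedModule)).
  - exists (fun j x y => fx j x y * g j x y + f j x y * gx j x y),
      (fun j x y => fy j x y * g j x y + f j x y * gy j x y).
    split; [| split].
    + apply rlc_plus; now apply rlc_mult.
    + apply rlc_plus; now apply rlc_mult.
    + intros x y Hxy j. destruct (Df x y Hxy j), (Dg x y Hxy j).
      split.
      * now apply (is_derive_mult (K := R_AbsRing) (fun z => f j z y) (fun z => g j z y));
          [| | exact Rmult_comm].
      * now apply (is_derive_mult (K := R_AbsRing) (fun z => f j x z) (fun z => g j x z));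
          [| | exact Rmult_comm].
Qed.

Lemma rational_log_class_differential (a s : nat -> R) :
  (forall j, 0 <= a j <= 1) -> (forall j, 0 <= s j <= 1) ->
  differential_class (off_poles a s) (rational_log_class a s).
Proof.
  intros Ha Hs f Kf. split.
  - now apply rational_log_class_bounded.
  - now apply rational_log_class_partials.
Qed.

(** The sum of the [w_j (c - ln q_j)], with the sign written as a factor to
    match the constructors of [rational_log_class]. *)
Definition log_potential (w a s : nat -> R) (c : R) : R -> R -> R :=
  weighted_sum w (fun j x y => c + - 1 * ln (softened_sqdist a s j x y)).

(** Termwise, [- Delta (- ln q) = 4 / q - 4 ((x - a)^2 + y^2) / q^2], and
    [(x - a)^2 + y^2 = q - s].  Convergence of the two series is part of the
    conclusion because [Series] has a value even where a series diverges. *)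
Theorem log_potential_spec (w a s : nat -> R) (c : R) :
  summable_weights w -> (forall j, 0 <= a j <= 1) -> (forall j, 0 <= s j <= 1) ->
  smooth_on (off_poles a s) (log_potential w a s c) /\
  (forall x y, off_poles a s x y ->
     - laplacian (log_potential w a s c) x y =
     Series (fun j => w j * (4 * s j / softened_sqdist a s j x y ^ 2)) /\
     ex_series (fun j => w j * (4 * s j / softened_sqdist a s j x y ^ 2)) /\
     ex_series (fun j => w j * (c + - 1 * ln (softened_sqdist a s j x y)))).
Proof.
  intros Hw Ha Hs.
  set (q := softened_sqdist a s).
  pose proof (rational_log_class_differential a s Ha Hs) as HK.
  pose proof (open_off_poles a s) as HD.
  assert (Kx : rational_log_class a s (fun j x y => -2 * (x - a j) * / q j x y))
    by (repeat constructor).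
  assert (Ky : rational_log_class a s (fun j x y => -2 * y * / q j x y))
    by (repeat constructor).
  assert (Kxx : rational_log_class a s
     (fun j x y => -2 * / q j x y + 4 * ((x - a j) * (x - a j)) * (/ q j x y * / q j x y)))
    by (repeat constructor).
  assert (Kyy : rational_log_class a s
     (fun j x y => -2 * / q j x y + 4 * (y * y) * (/ q j x y * / q j x y)))
    by (repeat constructor).
  assert (Kxy : rational_log_class a s
     (fun j x y => 4 * ((x - a j) * y) * (/ q j x y * / q j x y)))
    by (repeat constructor).
  assert (K0 : rational_log_class a s (fun j x y => c + - 1 * ln (q j x y)))
    by (repeat constructor).
  assert (P0 : have_partials_on (off_poles a s)
     (fun j x y => c + - 1 * ln (q j x y))
     (fun j x y => -2 * (x - a j) * / q j x y) (fun j x y => -2 * y * / q j x y)).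
  { intros x y Hxy j. pose proof (off_poles_pos a s x y Hxy j) as Hq.
    unfold q, softened_sqdist in *. split; (auto_derive; [lra | field; lra]). }
  assert (Px : have_partials_on (off_poles a s)
     (fun j x y => -2 * (x - a j) * / q j x y)
     (fun j x y => -2 * / q j x y + 4 * ((x - a j) * (x - a j)) * (/ q j x y * / q j x y))
     (fun j x y => 4 * ((x - a j) * y) * (/ q j x y * / q j x y))).
  { intros x y Hxy j. pose proof (off_poles_pos a s x y Hxy j) as Hq.
    unfold q, softened_sqdist in *. split; (auto_derive; [lra | field; lra]). }
  assert (Py : have_partials_on (off_poles a s)
     (fun j x y => -2 * y * / q j x y)
     (fun j x y => 4 * ((x - a j) * y) * (/ q j x y * / q j x y))
     (fun j x y => -2 * / q j x y + 4 * (y * y) * (/ q j x y * / q j x y))).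
  { intros x y Hxy j. pose proof (off_poles_pos a s x y Hxy j) as Hq.
    unfold q, softened_sqdist in *. split; (auto_derive; [lra | field; lra]). }
  split; [now apply (smooth_weighted_sum _ (rational_log_class a s)) |].
  intros x y Hxy.
  assert (EX : forall f, rational_log_class a s f -> ex_series (fun j => w j * f j x y)).
  { intros f Kf. destruct (HK f Kf) as [B _]. destruct (B x y Hxy) as [M L].
    apply ex_series_weighted with M; [exact Hw |].
    exact (locally_2d_singleton _ _ _ L). }
  assert (E2 : forall j,
    w j * (4 * s j / q j x y ^ 2) =
    - (w j * (-2 * / q j x y + 4 * ((x - a j) * (x - a j)) * (/ q j x y * / q j x y)) +
       w j * (-2 * / q j x y + 4 * (y * y) * (/ q j x y * / q j x y)))).
  { intros j. pose proof (off_poles_pos a s x y Hxy j) as Hq.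
    replace (s j) with (q j x y - (x - a j) ^ 2 - y ^ 2)
      by (unfold q, softened_sqdist; ring).
    fold q in Hq. field. lra. }
  pose proof (EX _ Kxx) as Exx. pose proof (EX _ Kyy) as Eyy. cbv beta in Exx, Eyy.
  split; [| split].
  - rewrite (laplacian_of_derivatives (off_poles a s) (log_potential w a s c)
       (weighted_sum w (fun j x y => -2 * (x - a j) * / q j x y))
       (weighted_sum w (fun j x y => -2 * y * / q j x y))
       (weighted_sum w (fun j x y =>
          -2 * / q j x y + 4 * ((x - a j) * (x - a j)) * (/ q j x y * / q j x y)))
       (weighted_sum w (fun j x y =>
          -2 * / q j x y + 4 * (y * y) * (/ q j x y * / q j x y)))); [| exact HD | | | | exact Hxy].
    + rewrite (Series_ext _ _ E2), Series_opp, Series_plus by assumption. reflexivity.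
    + now apply (is_derive_weighted_sum _ (rational_log_class a s)).
    + intros x' y' H'.
      exact (proj1 (is_derive_weighted_sum _ _ _ _ _ _ HD HK Hw Kx Kxx Kxy Px x' y' H')).
    + intros x' y' H'.
      exact (proj2 (is_derive_weighted_sum _ _ _ _ _ _ HD HK Hw Ky Kxy Kyy Py x' y' H')).
  - apply (ex_series_ext _ _ (fun j => eq_sym (E2 j))).
    apply (ex_series_opp (K := R_AbsRing) (V := R_NormedModule)
      (fun j => w j * (-2 * / q j x y + 4 * ((x - a j) * (x - a j)) * (/ q j x y * / q j x y)) +
       w j * (-2 * / q j x y + 4 * (y * y) * (/ q j x y * / q j x y)))).
    apply (ex_series_plus (K := R_AbsRing) (V := R_NormedModule) _ _ Exx Eyy).
  - exact (EX _ K0).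
Qed.

(** * Geometric weights and the Euclidean norm *)

Lemma le_Series_nonneg (a : nat -> R) (n : nat) :
  (forall k, 0 <= a k) -> ex_series a -> a n <= Series a.
Proof.
  intros Ha Hs.
  rewrite (Series_incr_n a (S n)) by (lia || exact Hs). simpl.
  assert (H1 : 0 <= Series (fun k => a (S (n + k)))).
  { apply Series_weights_nonneg. split; [intros k; apply Ha |].
    exact (proj1 (ex_series_incr_n (K := R_AbsRing) (V := R_NormedModule) a (S n)) Hs). }
  assert (H2 : a n <= sum_f_R0 a n).
  { destruct n as [| n]; simpl; [lra |].
    generalize (cond_pos_sum a n Ha). lra. }
  lra.
Qed.

Lemma is_series_halves (c : R) : is_series (fun j => c * (1 / 2) ^ j) (2 * c).
Proof.
  replace (2 * c) with (c * / (1 - 1 / 2)) by field.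
  apply (is_series_scal_l (K := R_AbsRing) (V := R_NormedModule) c (fun j => (1 / 2) ^ j)).
  apply is_series_geom. rewrite Rabs_pos_eq; lra.
Qed.

Lemma summable_halves (c : R) : 0 <= c -> summable_weights (fun j => c * (1 / 2) ^ j).
Proof.
  intros Hc. split.
  - intros j. apply Rmult_le_pos; [exact Hc |]. apply pow_le. lra.
  - exists (2 * c). apply is_series_halves.
Qed.

Lemma enorm_sqr (x y : R) : enorm x y ^ 2 = x ^ 2 + y ^ 2.
Proof. unfold enorm. apply pow2_sqrt. nra. Qed.

Lemma enorm_nonneg (x y : R) : 0 <= enorm x y.
Proof. apply sqrt_pos. Qed.

Lemma enorm_pos (x y : R) : (x, y) <> (0, 0) -> 0 < enorm x y.
Proof.
  intros Hne. apply sqrt_lt_R0. destruct (Req_dec x 0) as [-> | Hx0].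
  - destruct (Req_dec y 0) as [-> | Hy0]; [now contradiction Hne | nra].
  - nra.
Qed.

Lemma ln_sqdist (x y : R) : 0 < enorm x y -> ln (x ^ 2 + y ^ 2) = 2 * ln (enorm x y).
Proof. intros H. rewrite <- enorm_sqr, ln_pow by exact H. simpl. ring. Qed.

Lemma locally_sqdist_ge (x y : R) : 0 < enorm x y ->
  locally_2d (fun u v => (x ^ 2 + y ^ 2) / 2 <= u ^ 2 + v ^ 2) x y.
Proof.
  intros H. pose proof (enorm_sqr x y) as E.
  assert (Hm : 0 < (x ^ 2 + y ^ 2) / 2) by (rewrite <- E; nra).
  assert (Hc : continuity_2d_pt (fun u v => u * u + v * v) x y).
  { apply continuity_2d_pt_plus; apply continuity_2d_pt_mult;
      (apply continuity_2d_pt_id1 || apply continuity_2d_pt_id2). }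
  destruct (Hc (mkposreal _ Hm)) as [d Hd]. simpl in Hd.
  exists d. intros u v Hu Hv. specialize (Hd u v Hu Hv).
  apply Rabs_def2 in Hd. lra.
Qed.

Lemma off_poles_origin (x y : R) : 0 < enorm x y ->
  off_poles (fun _ => 0) (fun _ => 0) x y.
Proof.
  intros H. exists ((x ^ 2 + y ^ 2) / 2).
  split; [rewrite <- enorm_sqr; nra |].
  apply locally_2d_impl with (2 := locally_sqdist_ge x y H).
  apply locally_2d_forall. intros u v Huv j. unfold softened_sqdist. lra.
Qed.

(** Near a point other than the origin, [q_j] is bounded below either because
    its pole is close to the origin or because its shift [s j] is not small. *)
Lemma off_poles_of_far_or_soft (a s : nat -> R) :
  (forall j, 0 <= s j) ->
  (forall r, 0 < r -> exists m, 0 < m /\ forall j, a j ^ 2 <= r \/ m <= s j) ->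
  forall x y, 0 < enorm x y -> off_poles a s x y.
Proof.
  intros Hs H x y Hxy.
  assert (Hr : 0 < (x ^ 2 + y ^ 2) / 8) by (rewrite <- enorm_sqr; nra).
  destruct (H _ Hr) as (m & Hm & Hj).
  exists (Rmin m ((x ^ 2 + y ^ 2) / 8)). split; [now apply Rmin_pos |].
  apply locally_2d_impl with (2 := locally_sqdist_ge x y Hxy).
  apply locally_2d_forall. intros u v Huv j. unfold softened_sqdist.
  specialize (Hs j). destruct (Hj j) as [Ha | Hsj].
  - eapply Rle_trans; [apply Rmin_r |].
    (* This square is the inequality [(u - a)^2 >= u^2 / 2 - a^2]. *)
    assert (0 <= (u - 2 * a j) ^ 2) by apply pow2_ge_0. nra.
  - eapply Rle_trans; [apply Rmin_l |].
    generalize (pow2_ge_0 (u - a j)) (pow2_ge_0 v). lra.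
Qed.

(** * The size of the bumps *)

(** The solution of [B ^ (lambda - 1) = 4], that is, the least value from which
    [L ^ lambda] dominates [4 L]. *)
Definition growth_threshold (lambda : R) : R := Rpower 4 (/ (lambda - 1)).

Lemma growth_threshold_gt1 (lambda : R) : 1 < lambda -> 1 < growth_threshold lambda.
Proof.
  intros H. unfold growth_threshold.
  apply Rle_lt_trans with (Rpower 4 0); [rewrite Rpower_O; lra |].
  apply Rpower_lt; [lra |].
  apply Rinv_0_lt_compat. lra.
Qed.

Lemma Rpower_ge_linear (lambda L : R) : 1 < lambda -> growth_threshold lambda <= L ->
  4 * L <= Rpower L lambda.
Proof.
  intros H HL. pose proof (growth_threshold_gt1 lambda H) as HB.
  replace (Rpower L lambda) with (Rpower L (lambda - 1) * L).
  - apply Rmult_le_compat_r; [lra |].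
    replace 4 with (Rpower (growth_threshold lambda) (lambda - 1)).
    + apply Rle_Rpower_l; lra.
    + unfold growth_threshold. rewrite Rpower_mult, Rinv_l, Rpower_1; lra.
  - rewrite <- (Rpower_1 L) at 2 by lra. rewrite <- Rpower_plus. f_equal. ring.
Qed.

(** With this shift the maximum of [s / q^2], for a pole at distance [t] from
    the origin, is [1 / s = exp ((B - ln t) ^ lambda)], close to what [exp (v ^ lambda)]
    allows there. *)
Definition bump_softening (lambda t : R) : R :=
  exp (- Rpower (growth_threshold lambda - ln t) lambda).

Lemma ln_neg (t : R) : 0 < t < 1 -> ln t < 0.
Proof. intros H. rewrite <- ln_1. apply ln_increasing; lra. Qed.

Lemma bump_softening_range (lambda t : R) : 0 <= bump_softening lambda t <= 1.
Proof.
  unfold bump_softening. split; [apply Rlt_le, exp_pos |].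
  rewrite <- exp_0. left. apply exp_increasing.
  assert (0 < Rpower (growth_threshold lambda - ln t) lambda) by apply exp_pos. lra.
Qed.

Lemma exp_le (x y : R) : x <= y -> exp x <= exp y.
Proof. intros [H | ->]; [left; now apply exp_increasing | lra]. Qed.

(** At distance at most [2 t] from the origin the maximum [1 / s] of the
    left-hand side is at most the right-hand side; the summand [ln 2] pays for the factor
    [2].  Farther out the pole is at distance at least [t], and [s] is at most
    [t^4]. *)
Lemma bump_density_le (lambda t x y : R) :
  1 < lambda -> 0 < t < 1 -> 0 < enorm x y < 2 ->
  bump_softening lambda t / ((x - t) ^ 2 + y ^ 2 + bump_softening lambda t) ^ 2 <=
  exp (Rpower (ln 2 + growth_threshold lambda - ln (enorm x y)) lambda).
Proof.
  intros Hl Ht Hr.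
  pose proof (growth_threshold_gt1 lambda Hl) as HB.
  pose proof (ln_neg t Ht) as Hlt.
  pose proof (enorm_sqr x y) as E.
  set (B := growth_threshold lambda) in *. set (r := enorm x y) in *.
  assert (Hs : 0 < bump_softening lambda t) by apply exp_pos.
  set (sigma := bump_softening lambda t) in *.
  assert (Hd : 0 <= (x - t) ^ 2 + y ^ 2) by (generalize (pow2_ge_0 (x - t)) (pow2_ge_0 y); lra).
  destruct (Rle_or_lt r (2 * t)) as [Hrt | Hrt].
  - apply Rle_trans with (/ sigma).
    + replace (/ sigma) with (sigma / sigma ^ 2) by (field; lra).
      apply Rmult_le_compat_l; [lra |].
      apply Rinv_le_contravar; [apply pow_lt; lra |]. apply pow_incr. lra.
    + unfold sigma, bump_softening. rewrite <- exp_Ropp, Ropp_involutive. fold B.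
      apply exp_le. apply Rle_Rpower_l; [lra |].
      assert (ln r <= ln 2 + ln t) by (rewrite <- ln_mult by lra; apply ln_le; lra).
      lra.
  - apply Rle_trans with 1.
    2:{ rewrite <- exp_0. left. apply exp_increasing. apply exp_pos. }
    assert (Hx : x <= r) by nra.
    assert (Hdt : t ^ 2 <= (x - t) ^ 2 + y ^ 2) by nra.
    apply Rle_trans with (sigma / (t ^ 2) ^ 2).
    + apply Rmult_le_compat_l; [lra |].
      apply Rinv_le_contravar; [apply pow_lt, pow_lt; lra |].
      apply pow_incr. split; [apply pow2_ge_0 | lra].
    + apply Rle_div_l; [apply pow_lt, pow_lt; lra |]. rewrite Rmult_1_l.
      rewrite <- (exp_ln ((t ^ 2) ^ 2)) by (apply pow_lt, pow_lt; lra).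
      apply exp_le. fold B. rewrite <- pow_mult, ln_pow by lra. simpl.
      pose proof (Rpower_ge_linear lambda (B - ln t) Hl) as HL. fold B in HL.
      lra.
Qed.

(** [bump_softening lambda] increases with [t], so a pole that is not close to
    the origin has a shift that is not small. *)
Lemma bump_softening_dichotomy (lambda r t : R) :
  1 < lambda -> 0 < r -> 0 < t < 1 ->
  t ^ 2 <= r \/ bump_softening lambda (Rmin 1 r) <= bump_softening lambda t.
Proof.
  intros Hl Hr Ht. destruct (Rle_or_lt (t ^ 2) r) as [H | H]; [now left | right].
  pose proof (growth_threshold_gt1 lambda Hl) as HB.
  assert (Hrt : Rmin 1 r <= t) by (eapply Rle_trans; [apply Rmin_r | nra]).
  assert (Hr0 : 0 < Rmin 1 r) by (apply Rmin_pos; lra).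
  apply exp_le, Ropp_le_contravar, Rle_Rpower_l; [lra |].
  pose proof (ln_neg t Ht). pose proof (ln_le _ _ Hr0 Hrt). lra.
Qed.

(** * The two solutions *)

Lemma exists_small_argument (psi : R -> R) :
  (forall r, 0 < r < 1 -> 0 < psi r) -> filterlim psi (at_right 0) (locally 0) ->
  forall eta eps, 0 < eta -> 0 < eps -> exists t, 0 < t < 1 /\ t < eta /\ psi t < eps.
Proof.
  intros Hpos Hlim eta eps Heta Heps.
  destruct (proj1 (filterlim_locally _ _) Hlim (mkposreal eps Heps)) as [d Hd].
  assert (Hm : 0 < Rmin d (Rmin eta 1)) by (repeat apply Rmin_pos; (apply d || lra)).
  exists (Rmin d (Rmin eta 1) / 2).
  generalize (Rmin_l d (Rmin eta 1)) (Rmin_r d (Rmin eta 1)) (Rmin_l eta 1) (Rmin_r eta 1).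
  set (h := Rmin d (Rmin eta 1)) in *. intros. repeat split; try lra.
  assert (Hb : ball 0 d (h / 2)).
  { change (Rabs (h / 2 - 0) < d). rewrite Rminus_0_r, Rabs_pos_eq; lra. }
  assert (Hq : 0 < h / 2) by lra.
  specialize (Hd _ Hb Hq). change (Rabs (psi (h / 2) - 0) < eps) in Hd.
  apply Rabs_def2 in Hd. lra.
Qed.

Lemma log_ratio_lim (c : R) :
  0 <= c ->
  filterlim (fun p : R * R => (c - ln (enorm (fst p) (snd p))) / ln (1 / enorm (fst p) (snd p)))
    near_origin (locally 1).
Proof.
  intros Hc. apply filterlim_locally. intros eps.
  pose (rho := Rmin 1 (exp (- (c / eps)))).
  assert (Hrho : 0 < rho) by (apply Rmin_pos; [lra | apply exp_pos]).
  assert (Hrho2 : 0 < rho / 2) by lra.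
  exists (mkposreal _ Hrho2). intros [x y] [Hx Hy] Hne. simpl in *.
  change (Rabs (x - 0) < rho / 2) in Hx. change (Rabs (y - 0) < rho / 2) in Hy.
  rewrite Rminus_0_r in Hx, Hy.
  pose proof (enorm_pos x y Hne) as Hpos.
  assert (Hlt : enorm x y < rho).
  { apply Rsqr_incrst_0; [| apply enorm_nonneg | lra].
    unfold Rsqr. generalize (enorm_sqr x y). apply Rabs_def2 in Hx, Hy. nra. }
  set (r := enorm x y) in *.
  assert (H1 : r < 1) by (eapply Rlt_le_trans; [exact Hlt | apply Rmin_l]).
  assert (H2 : ln r < - (c / eps)).
  { rewrite <- (ln_exp (- (c / eps))). apply ln_increasing; [exact Hpos |].
    eapply Rlt_le_trans; [exact Hlt | apply Rmin_r]. }
  assert (H3 : ln r < 0) by (apply ln_neg; lra).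
  change (Rabs ((c - ln r) / ln (1 / r) - 1) < eps).
  unfold Rdiv at 2. rewrite Rmult_1_l, ln_Rinv by exact Hpos.
  replace ((c - ln r) / - ln r - 1) with (c / - ln r) by (field; lra).
  rewrite Rabs_pos_eq by (apply Rdiv_le_0_compat; lra).
  pose proof (cond_pos eps) as He.
  apply Rmult_lt_reg_r with (- ln r); [lra |].
  replace (c / - ln r * - ln r) with (eps * (c / eps)) by (field; lra). nra.
Qed.

Theorem theorem2p4 (lambda : R) (psi : R -> R)
  (Hlambda : 1 < lambda)
  (Hpsi_range : forall r : R, 0 < r < 1 -> 0 < psi r < 1)
  (Hpsi_cont : forall r : R, 0 < r < 1 -> continuous psi r)
  (Hpsi_lim : filterlim psi (at_right 0) (locally 0)) :
  exists u v : R -> R -> R,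
    smooth_on (punctured_ball 2) u /\
    smooth_on (punctured_ball 2) v /\
    (forall x y : R, punctured_ball 2 x y ->
       0 < u x y /\ 0 < v x y /\
       0 <= - laplacian u x y <= exp (Rpower (v x y) lambda) /\
       0 <= - laplacian v x y <= exp (u x y)) /\
    ~ is_bigO near_origin
        (fun p : R * R => u (fst p) (snd p))
        (fun p : R * R =>
           psi (enorm (fst p) (snd p)) *
           Rpower (ln (2 / enorm (fst p) (snd p))) lambda) /\
    filterlim
      (fun p : R * R =>
         v (fst p) (snd p) / ln (1 / enorm (fst p) (snd p)))
      near_origin (locally 1).
Proof.
  (* Weights of total mass [1 / 4], against the factor [4] of [- Delta (- ln q)]. *)
  pose (w := fun j : nat => 1 / 8 * (1 / 2) ^ j).
  assert (Hw : summable_weights w) by (apply summable_halves; lra).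
  assert (Hwpos : forall j, 0 < w j) by (intros j; apply Rmult_lt_0_compat; [| apply pow_lt]; lra).
  (* Weights of total mass [1 / 2], since [ln |p| = ln (|p|^2) / 2]. *)
  pose (w' := fun j : nat => 1 / 4 * (1 / 2) ^ j).
  assert (Hw' : summable_weights w') by (apply summable_halves; lra).
  assert (Ht : exists t : nat -> R, forall j : nat,
            0 < t j < 1 /\ t j < / INR (S j) /\ psi (t j) < w j / INR (S j)).
  { assert (HS : forall j, 0 < INR (S j)) by (intros; apply lt_0_INR; lia).
    pose (E := fun j => exists_small_argument psi (fun r Hr => proj1 (Hpsi_range r Hr))
                 Hpsi_lim _ _ (Rinv_0_lt_compat _ (HS j)) (Rdiv_lt_0_compat _ _ (Hwpos j) (HS j))).
    exists (fun j => proj1_sig (constructive_indefinite_description _ (E j))).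
    intros j. exact (proj2_sig (constructive_indefinite_description _ (E j))). }
  destruct Ht as [t Ht].
  pose (B := growth_threshold lambda).
  assert (HB : 1 < B) by now apply growth_threshold_gt1.
  assert (Hln2 : 0 < ln 2 < 1) by 
    (split; [rewrite <- ln_1; apply ln_increasing; lra |];
     rewrite <- (ln_exp 1); apply ln_increasing; [lra | generalize (exp_ineq1 1); lra]).
  pose (s := fun j => bump_softening lambda (t j)).
  assert (Hs : forall j, 0 <= s j <= 1) by (intros; apply bump_softening_range).
  assert (Hoff : forall x y, 0 < enorm x y -> off_poles t s x y).
  { apply off_poles_of_far_or_soft; [apply Hs |].
    intros r Hr. exists (bump_softening lambda (Rmin 1 r)). split; [apply exp_pos |].
    intros j. apply bump_softening_dichotomy; [exact Hlambda | exact Hr | apply Ht]. }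
  destruct (log_potential_spec w t s (ln 10) Hw) as [Usmooth Ulap];
    [intros j; specialize (Ht j); lra | exact Hs |].
  destruct (log_potential_spec w' (fun _ => 0) (fun _ => 0) (2 * (ln 2 + B)) Hw')
    as [Vsmooth Vlap]; [intros; lra | intros; lra |].
  set (u := log_potential w t s (ln 10)) in *.
  set (v := log_potential w' (fun _ => 0) (fun _ => 0) (2 * (ln 2 + B))) in *.
  assert (Vval : forall x y, 0 < enorm x y -> v x y = ln 2 + B - ln (enorm x y)).
  { intros x y Hxy. unfold v, log_potential, weighted_sum.
    rewrite (Series_ext _ (fun j => 2 * (ln 2 + B - ln (enorm x y)) * w' j)).
    - rewrite Series_scal_l. unfold w'. rewrite (is_series_unique _ _ (is_series_halves (1 / 4))).
      field.
    - intros j. unfold softened_sqdist.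
      replace ((x - 0) ^ 2 + y ^ 2 + 0) with (x ^ 2 + y ^ 2) by ring.
      rewrite ln_sqdist by exact Hxy. ring. }
  assert (Uterm : forall x y, punctured_ball 2 x y ->
     forall j, 0 < w j * (ln 10 + -1 * ln (softened_sqdist t s j x y))).
  { intros x y [Hr1 Hr2] j. apply Rmult_lt_0_compat; [apply Hwpos |].
    assert (ln (softened_sqdist t s j x y) < ln 10); [| lra].
    apply ln_increasing; [apply off_poles_pos, Hoff, Hr1 |].
    pose proof (enorm_sqr x y). destruct (Ht j) as [Htj _]. specialize (Hs j).
    unfold softened_sqdist. assert (-2 < x) by nra. nra. }
  exists u, v. split; [| split; [| split; [| split]]].
  - intros x y [Hxy _]. now apply Usmooth, Hoff.
  - intros x y [Hxy _]. now apply Vsmooth, off_poles_origin.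
  - intros x y [Hr1 Hr2].
    assert (Hball : punctured_ball 2 x y) by now split.
    destruct (Ulap x y (Hoff x y Hr1)) as (EU & SU & S0). rewrite EU.
    destruct (Vlap x y (off_poles_origin x y Hr1)) as (EV & _). rewrite EV.
    split; [| split; [| split; [split |]]].
    + apply Rlt_le_trans with (1 := Uterm x y Hball 0%nat).
      apply (le_Series_nonneg
           (fun j => w j * (ln 10 + -1 * ln (softened_sqdist t s j x y))) 0%nat); [| exact S0].
      intros k. now apply Rlt_le, Uterm.
    + rewrite Vval by exact Hr1.
      assert (ln (enorm x y) < ln 2) by (apply ln_increasing; lra). lra.
    + apply Series_weights_nonneg. split; [| exact SU].
      intros j. apply Rmult_le_pos; [apply Rlt_le, Hwpos |].
      apply Rdiv_le_0_compat; [specialize (Hs j); lra |].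
      apply pow_lt, off_poles_pos, Hoff, Hr1.
    + rewrite Vval by exact Hr1.
      set (M := exp (Rpower (ln 2 + B - ln (enorm x y)) lambda)).
      (* [M] is rewritten as [sum_j 4 w_j M] to compare the series term by term. *)
      replace M with (4 * M * (2 * (1 / 8))) by field.
      rewrite <- (is_series_unique _ _ (is_series_halves (1 / 8))), <- Series_scal_l.
      apply Series_le; [| apply ex_series_Rmult_l, Hw].
      intros j. pose proof (off_poles_pos t s x y (Hoff x y Hr1) j) as Hq.
      split.
      * apply Rmult_le_pos; [apply Rlt_le, Hwpos |].
        apply Rdiv_le_0_compat; [specialize (Hs j); lra | now apply pow_lt].
      * fold (w j).
        replace (4 * M * w j) with (w j * (4 * M)) by ring.
        apply Rmult_le_compat_l; [apply Rlt_le, Hwpos |].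
        unfold Rdiv. rewrite Rmult_assoc. apply Rmult_le_compat_l; [lra |].
        apply bump_density_le; [exact Hlambda | apply Ht | exact Hball].
    + rewrite (Series_ext _ (fun _ => 0 * 0)).
      * rewrite Series_scal_l, Rmult_0_l. split; [lra | apply Rlt_le, exp_pos].
      * intros j. unfold Rdiv. ring.
  - intros [C [eps HC]].
    (* A pole within distance [eps] of the origin, with index at least [C]. *)
    destruct (INR_archimed 1 (Rmax C (/ eps)) Rlt_0_1) as [n Hn].
    rewrite Rmult_1_r in Hn.
    generalize (Rmax_l C (/ eps)) (Rmax_r C (/ eps)). intros HnC Hne.
    destruct (Ht n) as (Htn & Htn' & Hpsin).
    assert (HS : INR n < INR (S n)) by (apply lt_INR; lia).
    assert (He : 0 < / eps) by apply Rinv_0_lt_compat, eps.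
    assert (Hteps : t n < eps).
    { eapply Rlt_trans; [exact Htn' |]. rewrite <- (Rinv_inv eps).
      apply Rinv_lt_contravar; [| lra]. apply Rmult_lt_0_compat; lra. }
    assert (Hnorm : enorm (t n) 0 = t n).
    { unfold enorm. replace (t n ^ 2 + 0 ^ 2) with (t n ^ 2) by ring.
      rewrite sqrt_pow2; lra. }
    assert (Hball : ball (0, 0) eps (t n, 0)).
    { split; simpl.
      - change (Rabs (t n - 0) < eps). rewrite Rminus_0_r, Rabs_pos_eq; lra.
      - apply ball_center. }
    assert (Hneq : (t n, 0) <> (0, 0)) by (intros Heq; injection Heq; lra).
    specialize (HC _ Hball Hneq). simpl in HC. rewrite Hnorm in HC.
    assert (Hpb : punctured_ball 2 (t n) 0) by (split; rewrite Hnorm; lra).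
    set (P := Rpower (ln (2 / t n)) lambda) in *.
    assert (HP : 0 < P) by apply exp_pos.
    destruct (Hpsi_range (t n) Htn) as [Hpsi0 _].
    assert (Hu : w n * P <= u (t n) 0).
    { apply Rle_trans with (w n * (ln 10 + -1 * ln (softened_sqdist t s n (t n) 0))).
      - apply Rmult_le_compat_l; [apply Rlt_le, Hwpos |].
        unfold softened_sqdist.
        replace ((t n - t n) ^ 2 + 0 ^ 2 + s n) with (s n) by ring.
        unfold s, bump_softening. rewrite ln_exp. fold B.
        assert (0 < ln 10) by (rewrite <- ln_1; apply ln_increasing; lra).
        assert (P <= Rpower (B - ln (t n)) lambda); [| lra].
        pose proof (ln_neg _ Htn). unfold P.
        rewrite ln_div by lra. apply Rle_Rpower_l; lra.
      - apply (le_Series_nonneg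
           (fun j => w j * (ln 10 + -1 * ln (softened_sqdist t s j (t n) 0))) n).
        + intros k. now apply Rlt_le, Uterm.
        + apply Ulap, Hoff. rewrite Hnorm. lra. }
    assert (Hpsi' : INR (S n) * psi (t n) < w n).
    { replace (w n) with (INR (S n) * (w n / INR (S n))) by (field; lra).
      apply Rmult_lt_compat_l; [lra | exact Hpsin]. }
    assert (HuC : C * (psi (t n) * P) < u (t n) 0).
    { apply Rlt_le_trans with (2 := Hu). rewrite <- Rmult_assoc.
      apply Rmult_lt_compat_r; [exact HP |].
      apply Rle_lt_trans with (2 := Hpsi'). apply Rmult_le_compat_r; lra. }
    rewrite (Rabs_pos_eq (psi (t n) * P)) in HC by (apply Rlt_le; now apply Rmult_lt_0_compat).
    generalize (Rle_abs (u (t n) 0)). lra.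
  - apply filterlim_ext_loc with
      (fun p : R * R => (ln 2 + B - ln (enorm (fst p) (snd p))) / ln (1 / enorm (fst p) (snd p)));
      [| apply log_ratio_lim; lra].
    exists (mkposreal 1 Rlt_0_1). intros [x y] _ Hne. symmetry. f_equal.
    now apply Vval, enorm_pos.
Qed.
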